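(* Let $r\ge 3$ be an integer and let $n$ be sufficiently large. Suppose $H$ is a $4$-uniform hypergraph on $n$ vertices with at least $\left(\frac{r-2}{r-1}-10^{-33}r^{-70}\right)\binom{n}{4}$ edges which contains no copy of ${\cal C}^{(4)}_r$. Then $r=2^p+1$ for some integer $p\ge 1$.
   Context: ${\cal C}^{(4)}_r$ is the $4$-uniform hypergraph obtained by taking pairwise disjoint sets $P_1,\dots,P_r$ each of size $2$ and taking as edges all sets $P_i\cup P_j$ with $i\neq j$. *)

(* Defs.v *)
From mathcomp Require Import all_boot all_order all_algebra.
Set Implicit Arguments. Unset Strict Implicit. Unset Printing Implicit Defensive.

Definition uniform4 (n : nat) (H : {set {set 'I_n}}) : bool :=
  [forall e in H, #|e| == 4].

(* The vertex set of C^(4)_r is 'I_r * 'I_2; the pair P_i is {(i,0),(i,1)}. *)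
Definition Cpair (r : nat) (i : 'I_r) : {set 'I_r * 'I_2} :=
  [set x | x.1 == i].

Definition contains_Cr (r n : nat) (H : {set {set 'I_n}}) : Prop :=
  exists f : 'I_r * 'I_2 -> 'I_n,
    injective f /\
    forall i j : 'I_r, i != j -> f @: (Cpair i :|: Cpair j) \in H.

(* Main.v *)
Require Import Defs.
From mathcomp Require Import all_boot all_order all_fingroup all_algebra all_solvable.
From mathcomp Require Import ring lra zify.
Set Implicit Arguments. Unset Strict Implicit. Unset Printing Implicit Defensive.
Import Order.TTheory GRing.Theory Num.Theory.

(* Call two ordered pairs of vertices adjacent when their union is an edge of H.
   With s = r - 1, this graph on n^2 points has no clique of size s + 1 and almost
   Turan density, so by stability it is nearly complete s-partite: pairs receive s
   colours so that, for almost all quadruples, each of the three perfect matchings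
   is monochromatic exactly when the quadruple is not an edge. In particular the
   three matchings are monochromatic simultaneously.
   A counting argument yields a vertex x all of whose colour neighbourhoods N_i
   have linear size. For almost all a in N_i and b in N_j the colour of ab depends
   only on (i, j); call it i + j. Good quadruples show that + is commutative and
   associative with i + (i + j) = j, so the s colours form an elementary abelian
   2-group. *)

(** * Finite Boolean groups *)

(** The translations z -> x + z form a permutation group in bijection with T. Each is an involution,
    so by Cauchy 2 is the only prime that can divide its order. Nonemptiness supplies the identity,
    as translation by x + x. *)
Lemma card_boolean_group (T : finType) (op : T -> T -> T) :
  0 < #|T| -> associative op -> commutative op ->
  (forall x y, op x (op x y) = y) -> exists p, #|T| = 2 ^ p.
Proof.
move=> T0 opA opC opK.
have op_inj x : injective (op x) by apply: (can_inj (opK x)).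
pose trans x : {perm T} := perm (op_inj x).
have transM x y : (trans x * trans y)%g = trans (op x y).
  by apply/permP=> z; rewrite permM !permE opA (opC y).
have trans_inj : injective trans.
  by move=> x y /permP/(_ x); rewrite !permE (opC y) => /op_inj.
have gG : group_set [set trans x | x : T].
  apply/group_setP; split.
    case/card_gt0P: T0 => x _; apply/imsetP; exists (op x x) => //.
    by apply/permP=> z; rewrite perm1 permE -opA opK.
  by move=> _ _ /imsetP[x _ ->] /imsetP[y _ ->]; rewrite transM imset_f.
pose G := Group gG.
have cG : #|G| = #|T| by rewrite /= card_imset.
have G2 : 2.-nat #|G|.
  apply/pnatP=> // q q_pr /(Cauchy q_pr) [x /imsetP[y _ xE] xq].
  have : (#[x]%g %| 2)%N.
    rewrite order_dvdn; apply/eqP; rewrite expgS expg1 xE transM.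
    by apply/permP=> z; rewrite perm1 permE -opA opK.
  by rewrite xq dvdn_prime2 // inE.
by exists (logn 2 #|T|); rewrite -p_part -cG part_pnat_id.
Qed.

(** * Colouring a clique-free graph *)

(* Füredi's proof of stability: the first class consists of the non-neighbours
   of a vertex of maximal degree, the others are found among its neighbours. *)
Lemma clique_free_coloring_in (P : finType) (G : rel P) (s : nat) (A : {set P}) :
  symmetric G ->
  (forall t : seq P, {subset t <= A} -> pairwise G t -> size t <= s) ->
  exists col : P -> nat,
    [/\ {in A, forall x, col x < s},
        forall x y, G x =1 G y -> col x = col y
      & \sum_(x in A) \sum_(y in A)
          (G x y + (G x y && (col x == col y)) + (col x == col y)) <= #|A| ^ 2].
Proof.
move=> symG; elim: s A => [|s IHs] A cliqueA.
  have A0 x : x \in A -> False.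
    move=> xA; suff: size [:: x] <= 0 by [].
    by apply: cliqueA => // y; rewrite inE => /eqP ->.
  exists (fun=> 0); split=> [x /A0 []|//|].
  by rewrite big1 // => x /A0.
have [->|[x0 x0A]] := set_0Vmem A.
  by exists (fun=> 0); split=> [x|//|]; rewrite ?inE ?big_set0.
pose deg x := \sum_(y in A) G x y.
case: (arg_maxnP deg x0A) => x xA max_x.
pose B := [set y in A | G x y]; pose C := A :\: B.
have sBA : B \subset A by apply/subsetP=> y; rewrite inE => /andP[].
have degx : deg x = #|B|.
  rewrite /deg -sum1_card big_mkcond [RHS]big_mkcond /=.
  by apply: eq_bigr => y _; rewrite inE; case: (y \in A) => //=; case: (G x y).
have [|col [colB colG sumB]] := IHs B.
  move=> t tB ct; have := cliqueA (x :: t); rewrite /= ltnS; apply.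
    by move=> y /[!inE] /predU1P[->//|/tB]; apply: (subsetP sBA).
  by rewrite ct andbT; apply/allP=> y /tB; rewrite inE => /andP[].
(* The non-neighbours of x form the new class 0. Colours depend on adjacencies only, so vertices
   with equal neighbourhoods share one; this will later give ab and ba the same colour. *)
pose col' y := if G x y then (col y).+1 else 0.
exists col'; split; rewrite /col'.
- by move=> y yA; case: ifP => // Gxy; rewrite ltnS colB // inE yA.
- by move=> y z Gyz; rewrite !(symG x) Gyz (colG y z).
rewrite -/col'.
(* Inside B the sum of [F] is at most |B|^2 by induction. Between B and C the colours differ, so [F]
   is [G]; inside C it is 2 [G] + 1. Since x has maximal degree |B|, the vertices of C have total
   degree at most |C| |B|, and everything adds up to at most (|B| + |C|)^2. *)
pose F y z : nat := G y z + (G y z && (col' y == col' z)) + (col' y == col' z).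
rewrite -[X in X <= _]/(\sum_(y in A) \sum_(z in A) F y z).
have FC y z : F y z = F z y by rewrite /F (symG y) [col' y == _]eq_sym.
have splitA (h : P -> nat) :
    \sum_(y in A) h y = \sum_(y in B) h y + \sum_(y in C) h y.
  rewrite (bigID (mem B)) /=; congr (_ + _); apply: eq_bigl => y.
    by rewrite andb_idl // => /(subsetP sBA).
  by rewrite !inE andbC.
have cA : #|A| = #|B| + #|C| by rewrite -!sum1_card splitA.
have xB y : y \in B -> G x y by rewrite inE => /andP[].
have xC y : y \in C -> G x y = false.
  by rewrite !inE => /andP[] /[swap] ->; case: (G x y).
have FBB : \sum_(y in B) \sum_(z in B) F y z <= #|B| ^ 2.
  apply: leq_trans sumB; rewrite leq_eqVlt; apply/orP; left; apply/eqP.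
  by apply: eq_bigr => y /xB Gy; apply: eq_bigr => z /xB Gz; rewrite /F /col' Gy Gz eqSS.
have FCB : \sum_(y in C) \sum_(z in B) F y z = \sum_(y in C) \sum_(z in B) G y z.
  apply: eq_bigr => y /xC Gy; apply: eq_bigr => z /xB Gz.
  by rewrite /F /col' Gy Gz /= andbF !addn0.
have FCC : \sum_(y in C) \sum_(z in C) F y z =
    2 * (\sum_(y in C) \sum_(z in C) G y z) + #|C| ^ 2.
  rewrite expnS expn1 -sum_nat_const big_distrr -big_split /=.
  apply: eq_bigr => y /xC Gy; rewrite big_distrr -[#|C|]sum1_card -big_split /=.
  by apply: eq_bigr => z /xC Gz; rewrite /F /col' Gy Gz /= andbT addnn mul2n.
have degC : \sum_(y in C) \sum_(z in B) G y z + \sum_(y in C) \sum_(z in C) G y z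
    <= #|C| * #|B|.
  rewrite -big_split /= -sum_nat_const; apply: leq_sum => y yC.
  by rewrite -splitA -degx; apply: max_x; move: yC; rewrite inE => /andP[].
rewrite splitA [X in X + _](_ : _ =
    \sum_(y in B) \sum_(z in B) F y z + \sum_(y in C) \sum_(z in B) F y z); last first.
  rewrite [X in _ = _ + X]exchange_big -big_split /=; apply: eq_bigr => y _.
  by rewrite splitA; congr (_ + _); apply: eq_bigr => z _.
rewrite [X in _ + _ + X](_ : _ =
    \sum_(y in C) \sum_(z in B) F y z + \sum_(y in C) \sum_(z in C) F y z); last first.
  by rewrite -big_split /=; apply: eq_bigr => y _; rewrite splitA.
rewrite FCB FCC cA.
move: FBB degC; set u := \sum_(_ in B) _; set v := \sum_(_ in C) _.
set w := \sum_(_ in C) _.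
by rewrite !expnS !expn0; nia.
Qed.

Local Open Scope ring_scope.

(** * Fibre sizes and collisions *)

Lemma sumr_const_card (R : realFieldType) (T : finType) (k : R) :
  \sum_(x : T) k = #|T|%:R * k.
Proof. by rewrite sumr_const mulr_natl. Qed.

Lemma sum_fibers (R : realFieldType) (T : finType) (A : pred T) (s : nat)
    (f : T -> 'I_s) :
  \sum_(i < s) \sum_(x | A x) (f x == i)%:R = \sum_(x | A x) 1 :> R.
Proof.
rewrite exchange_big; apply: eq_bigr => x _ /=.
by rewrite (bigD1 (f x)) //= eqxx big1 ?addr0 // => i /negPf; rewrite eq_sym => ->.
Qed.

Lemma sum_fibers_sqr (R : realFieldType) (T : finType) (A : pred T) (s : nat)
    (f : T -> 'I_s) :
  \sum_(x | A x) \sum_(y | A y) (f x == f y)%:R =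
  \sum_(i < s) (\sum_(x | A x) (f x == i)%:R) ^+ 2 :> R.
Proof.
under [RHS]eq_bigr => i _ do rewrite expr2 big_distrlr.
rewrite [RHS]exchange_big; apply: eq_bigr => x _ /=.
rewrite [RHS]exchange_big; apply: eq_bigr => y _ /=.
rewrite (bigD1 (f x)) //= eqxx mul1r [f x == _]eq_sym big1 ?addr0 // => i.
by rewrite eq_sym => /negPf ->; rewrite mul0r.
Qed.

(** Collisions number the sum of the squared fibre sizes. These sizes have mean M / s, so that sum
    is M^2 / s plus all squared deviations from the mean, of which only the one for i is kept. *)
Lemma fiber_variance (R : realFieldType) (T : finType) (A : pred T) (s : nat)
    (f : T -> 'I_s) (i : 'I_s) (M : R) :
  M = \sum_(x | A x) 1 ->
  (\sum_(x | A x) (f x == i)%:R - M / s%:R) ^+ 2 + M ^+ 2 / s%:R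
    <= \sum_(x | A x) \sum_(y | A y) (f x == f y)%:R.
Proof.
move=> MA; rewrite sum_fibers_sqr.
have s0 : s%:R != 0 :> R by rewrite pnatr_eq0; case: s i {f} => [[]|].
set S := fun j => \sum_(x | A x) (f x == j)%:R : R.
have SM : \sum_j S j = M by rewrite MA sum_fibers.
rewrite -lerBrDr; apply: (@le_trans _ _ (\sum_j (S j - M / s%:R) ^+ 2)).
  by rewrite (bigD1 i) //= lerDl sumr_ge0 // => j _; rewrite sqr_ge0.
under eq_bigr => j _ do rewrite sqrrB -addrA.
rewrite big_split /= lerD2l big_split /= sumrN sumrMnl -mulr_suml SM.
rewrite sumr_const card_ord -mulr_natr -[_ *+ s]mulr_natr le_eqVlt.
by apply/orP; left; apply/eqP; field.
Qed.

Lemma sum_pairs (R : realFieldType) (V : finType) (F : V -> V -> V -> V -> R) :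
  \sum_a \sum_b \sum_d \sum_e F a b d e =
  \sum_(x : V * V) \sum_(y : V * V) F x.1 x.2 y.1 y.2.
Proof.
rewrite (pair_bigA _ (fun a b => \sum_d \sum_e F a b d e)) /=.
by apply: eq_bigr => x _; rewrite pair_bigA.
Qed.

Lemma sum_pairs_fst (R : realFieldType) (V : finType) (X : pred V) (F : V * V -> R) :
  \sum_(p | X p.1) F p = \sum_(x | X x) \sum_u F (x, u).
Proof.
rewrite pair_big_dep /=.
by apply: eq_big => [p|[x u] //]; rewrite andbT.
Qed.

(** * A vertex with large neighbourhoods in every colour *)

(** The three equalities are the perfect matchings of a, b, d, e being monochromatic. Only their
    agreement with one another is recorded, so the hypergraph disappears from here on. *)
Definition mismatch (V : finType) (s : nat) (c : V -> V -> 'I_s) (a b d e : V) : bool :=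
  ~~ (((c a b == c d e) == (c a d == c b e)) &&
      ((c a b == c d e) == (c a e == c b d))).

(** Collisions among the n^2 pairs exceed their minimum n^4 / s by at most (n^2 / (4 s^2))^2, so by
    [fiber_variance] no colour class deviates from n^2 / s by more than n^2 / (4 s^2). *)
Lemma color_class_bound (R : realFieldType) (V : finType) (s : nat)
    (c : V -> V -> 'I_s) (i : 'I_s) (n : R) :
  n = #|V|%:R ->
  \sum_a \sum_b \sum_d \sum_e (c a b == c d e)%:R
    <= n ^+ 4 / s%:R + n ^+ 4 / (16 * s%:R ^+ 4) ->
  \sum_a \sum_b (c a b == i)%:R <= n ^+ 2 / s%:R + n ^+ 2 / (4 * s%:R ^+ 2).
Proof.
move=> nV.
have s0 : 0 < s%:R :> R by rewrite ltr0n (leq_ltn_trans _ (ltn_ord i)).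
rewrite sum_pairs => Qle; rewrite pair_bigA /=; move: Qle.
have M : n ^+ 2 = \sum_(x : V * V) 1.
  by rewrite sumr_const_card card_prod natrM nV mulr1.
have /= := fiber_variance (fun x : V * V => c x.1 x.2) i M.
set S := \sum_(p | _) _; set Q := \sum_(p : V * V | _) _ => SQ Qle.
have {SQ Qle}S2 : (S - n ^+ 2 / s%:R) ^+ 2 <= (n ^+ 2 / (4 * s%:R ^+ 2)) ^+ 2.
  rewrite -(lerD2r ((n ^+ 2) ^+ 2 / s%:R)); apply: le_trans SQ (le_trans Qle _).
  by rewrite le_eqVlt; apply/orP; left; apply/eqP; field; rewrite lt0r_neq0.
rewrite -lerBlDl; apply: le_trans (ler_norm _) _.
rewrite -ler_sqr ?nnegrE ?real_normK ?num_real //.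
by rewrite divr_ge0 ?sqr_ge0 // mulr_ge0 ?sqr_ge0.
Qed.

(* If the vertices of X all have small degree in colour i, then the colour degree
   vectors of X average to a vector far from uniform; but their mutual scalar
   products count pairs of a fixed colour, hence are at most about 1 / s. *)
Lemma poor_vertices_bound (R : realFieldType) (V : finType) (s : nat)
    (c : V -> V -> 'I_s) (i : 'I_s) (X : pred V) (n : R) :
  n = #|V|%:R -> 0 < n ->
  \sum_a \sum_b \sum_d \sum_e (c a b == c d e)%:R
    <= n ^+ 4 / s%:R + n ^+ 4 / (16 * s%:R ^+ 4) ->
  \sum_a \sum_b \sum_d \sum_e (mismatch c a b d e)%:R <= n ^+ 4 / (16 * s%:R ^+ 4) ->
  (forall x, X x -> \sum_u (c x u == i)%:R <= n / (4 * s%:R)) ->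
  \sum_(x | X x) 1 < n / (2 * s%:R).
Proof.
move=> nV n0 cQ bad poorX; rewrite ltNge; apply/negP.
set m : R := \sum_(x | X x) 1 => mge.
have s0 : 0 < s%:R :> R by rewrite ltr0n (leq_ltn_trans _ (ltn_ord i)).
have M : m * n = \sum_(x : V * V | X x.1) 1.
  rewrite sum_pairs_fst mulr_suml; apply: eq_bigr => x _.
  by rewrite sumr_const_card -nV mulr1 mul1r.
have /= := fiber_variance (fun x : V * V => c x.1 x.2) i M.
set S := \sum_(p | _) _; set W := \sum_(p | _) _ => SW.
have Sle : S <= m * (n / (4 * s%:R)).
  rewrite /S sum_pairs_fst mulr_suml.
  by apply: ler_sum => x /poorX; rewrite mul1r.
have Wle : W <= m ^+ 2 * (n ^+ 2 / s%:R + n ^+ 2 / (4 * s%:R ^+ 2))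
    + n ^+ 4 / (16 * s%:R ^+ 4).
  have -> : W = \sum_(x | X x) \sum_(y | X y) \sum_u \sum_v (c x u == c y v)%:R.
    rewrite /W sum_pairs_fst; apply: eq_bigr => x _.
    by rewrite exchange_big /= sum_pairs_fst; apply: eq_bigr => y _; rewrite exchange_big.
  (* Off mismatches, xu and yv share a colour exactly when uv has the colour of xy. For fixed x and
     y this counts the pairs uv of one colour, which [color_class_bound] controls. *)
  apply: (@le_trans _ _ (\sum_(x | X x) \sum_(y | X y)
     (\sum_u \sum_v (c u v == c x y)%:R + \sum_u \sum_v (mismatch c x y u v)%:R))).
    apply: ler_sum => x _; apply: ler_sum => y _; rewrite -big_split /=.
    apply: ler_sum => u _; rewrite -big_split /=; apply: ler_sum => v _.
    rewrite -natrD ler_nat /mismatch [c u v == _]eq_sym.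
    by case: (c x y == c u v); case: (c x u == c y v); case: (c x v == c y u).
  under eq_bigr => x _ do rewrite big_split /=.
  rewrite big_split /=; apply: lerD.
    rewrite expr2 -mulrA mulr_suml; apply: ler_sum => x _.
    rewrite mul1r mulr_suml; apply: ler_sum => y _.
    by rewrite mul1r; apply: color_class_bound.
  apply: le_trans bad.
  rewrite [leLHS]big_mkcond; apply: ler_sum => x _.
  have ge0 y : 0 <= \sum_u \sum_v (mismatch c x y u v)%:R :> R.
    by apply: sumr_ge0 => u _; apply: sumr_ge0.
  case: (X x); last by apply: sumr_ge0.
  by rewrite [leLHS]big_mkcond; apply: ler_sum => y _; case: (X y).
have m0 : 0 < m by apply: lt_le_trans mge; rewrite divr_gt0 // mulr_gt0.
(* The assumption m >= n / (2 s), to be refuted, makes the mismatch error small relative to m^2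
   n^2. *)
have nle : n ^+ 4 / (16 * s%:R ^+ 4) <= m ^+ 2 * n ^+ 2 / (4 * s%:R ^+ 2).
  have -> : n ^+ 4 / (16 * s%:R ^+ 4) = (n / (2 * s%:R)) ^+ 2 * n ^+ 2 / (4 * s%:R ^+ 2).
    by field; rewrite lt0r_neq0.
  rewrite ler_wpM2r ?invr_ge0 ?mulr_ge0 ?sqr_ge0 // ler_wpM2r ?sqr_ge0 //.
  by rewrite ler_sqr // nnegrE ltW // divr_gt0 // mulr_gt0.
(* [z] is the equidistributed number of pairs of colour i in X x V. Poverty gives S <= z / 4, hence
   a squared deviation of at least 9 z^2 / 16, whereas the collision bound leaves room for only z^2
   / 2. *)
pose z := m * n / s%:R; have z0 : 0 < z by rewrite divr_gt0 ?mulr_gt0.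
have {}Sle : S <= z / 4.
  apply: le_trans Sle _; rewrite le_eqVlt; apply/orP; left; apply/eqP.
  by rewrite /z; field; rewrite lt0r_neq0.
have {}Wle : W <= z ^+ 2 * s%:R + z ^+ 2 / 4 + z ^+ 2 / 4.
  apply: le_trans Wle (le_trans (lerD (lexx _) nle) _).
  by rewrite le_eqVlt; apply/orP; left; apply/eqP; rewrite /z; field; rewrite lt0r_neq0.
have {}SW : (S - z) ^+ 2 + z ^+ 2 * s%:R <= W.
  apply: le_trans SW; rewrite le_eqVlt; apply/orP; left; apply/eqP.
  by rewrite /z; field; rewrite lt0r_neq0.
have zS : z ^+ 2 * (9 / 16) <= (S - z) ^+ 2.
  rewrite -[(S - z) ^+ 2]sqrrN opprB (_ : 9 / 16 = (3 / 4) ^+ 2); last by field.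
  by rewrite -exprMn ler_sqr ?nnegrE; lra.
have : z ^+ 2 * (9 / 16) <= z ^+ 2 / 2.
  move: zS (le_trans SW Wle); move: (z ^+ 2) (z ^+ 2 * s%:R) ((S - z) ^+ 2) => p q t.
  lra.
by rewrite ler_pM2l ?exprn_gt0 //; lra.
Qed.

(** Each colour has fewer than n / (2 s) poor vertices, so fewer than n / 2 vertices are poor in
    some colour. By Markov at most n / 2 vertices lie in more than twice the average number of
    mismatches. Some vertex avoids both sets. *)
Lemma rich_vertex (R : realFieldType) (V : finType) (s : nat)
    (c : V -> V -> 'I_s) (n delta : R) :
  n = #|V|%:R -> 0 < n -> (0 < s)%N -> 0 < delta -> delta <= 1 / (16 * s%:R ^+ 4) ->
  \sum_a \sum_b \sum_d \sum_e (c a b == c d e)%:R <= n ^+ 4 / s%:R + delta * n ^+ 4 ->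
  \sum_a \sum_b \sum_d \sum_e (mismatch c a b d e)%:R <= delta * n ^+ 4 ->
  exists2 x, forall i, n / (4 * s%:R) <= \sum_u (c x u == i)%:R
           & \sum_a \sum_b \sum_d (mismatch c x a b d)%:R <= 2 * delta * n ^+ 3.
Proof.
move=> nV n0 s_gt0 delta0 dle cQ bad.
have s0 : 0 < s%:R :> R by rewrite ltr0n.
pose D x : R := \sum_a \sum_b \sum_d (mismatch c x a b d)%:R.
pose deg x i : R := \sum_u (c x u == i)%:R.
have D0 x : 0 <= D x by do 3!apply: sumr_ge0 => ? _.
have dn : delta * n ^+ 4 <= n ^+ 4 / (16 * s%:R ^+ 4).
  by rewrite mulrC -[_ ^-1]mul1r ler_pM2l ?exprn_gt0.
have poor i : \sum_(x | deg x i < n / (4 * s%:R)) 1 < n / (2 * s%:R) :> R.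
  apply: (@poor_vertices_bound R V s c i) => //; first exact: le_trans cQ (lerD (lexx _) dn).
    exact: le_trans bad dn.
  by move=> x /ltW.
have [/existsP[x /andP[/forallP rx Dx]]|] :=
  boolP [exists x, [forall i, n / (4 * s%:R) <= deg x i] && (D x <= 2 * delta * n ^+ 3)].
  by exists x.
rewrite negb_exists => /forallP none; exfalso.
have few : \sum_(x | 2 * delta * n ^+ 3 < D x) 1 <= n / 2 :> R.
  rewrite -(@ler_pM2r _ (2 * delta * n ^+ 3)) ?mulr_gt0 ?exprn_gt0 // mulr_suml.
  rewrite (_ : n / 2 * _ = delta * n ^+ 4); last by field.
  apply: le_trans bad; rewrite [leLHS]big_mkcond; apply: ler_sum => x _.
  by case: ifP => [/ltW Dx|_]; rewrite ?mul1r // D0.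
have : n <= \sum_(x | 2 * delta * n ^+ 3 < D x) 1
          + \sum_i \sum_(x | deg x i < n / (4 * s%:R)) 1.
  rewrite [n in n <= _](_ : n = \sum_(x : V) 1); last by rewrite sumr_const_card mulr1.
  under [X in _ + X]eq_bigr => i _ do rewrite big_mkcond /=.
  rewrite exchange_big /= [X in X + _]big_mkcond -big_split /=; apply: ler_sum => x _.
  have ge0 (P : pred 'I_s) : 0 <= \sum_i (if P i then 1 else 0) :> R.
    by apply: sumr_ge0 => i _; case: ifP.
  have := none x; rewrite negb_and negb_forall -ltNge.
  case/orP=> [/existsP[i]|->]; last by rewrite lerDl ge0.
  rewrite -ltNge => di; rewrite (bigD1 i) //= di addrCA lerDl addr_ge0 //.
    by case: ifP.
  by apply: sumr_ge0 => j _; case: ifP.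
apply/negP; rewrite -ltNge.
apply: (@lt_le_trans _ _ (n / 2 + \sum_(i < s) n / (2 * s%:R))).
  apply: ler_ltD => //; apply: ltr_sum => [|i _]; last exact: poor.
  by apply/hasP; exists (Ordinal s_gt0); rewrite ?mem_index_enum.
rewrite sumr_const card_ord -mulr_natr le_eqVlt; apply/orP; left; apply/eqP.
by field; rewrite lt0r_neq0.
Qed.

(** * The colour of a pair as a function of its classes *)

(* If ab and a'b have different colours while a, a' lie in N_i, then for every d
   joined to x in the colour of ab, one of xabd and xa'bd is a mismatch. *)
Lemma color_change_bound (R : realFieldType) (V : finType) (s : nat)
    (c : V -> V -> 'I_s) (x : V) (i j : 'I_s) (n rho beta : R) :
  n = #|V|%:R -> 0 < n -> 0 < rho ->
  (forall k, rho * n <= \sum_u (c x u == k)%:R) ->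
  \sum_a \sum_b \sum_d (mismatch c x a b d)%:R <= beta * n ^+ 3 ->
  \sum_a \sum_a' \sum_b
     [&& c x a == i, c x a' == i, c x b == j & c a b != c a' b]%:R
    <= 2 * beta / rho * n ^+ 3.
Proof.
move=> nV n0 rho0 rich bad.
rewrite -(@ler_pM2r _ (rho * n)) ?mulr_gt0 //.
rewrite (_ : 2 * beta / rho * n ^+ 3 * (rho * n) =
   n * (beta * n ^+ 3) + n * (beta * n ^+ 3)); last by field; rewrite lt0r_neq0.
pose m a b d : R := (mismatch c x a b d)%:R.
apply: (@le_trans _ _ (\sum_a \sum_a' \sum_b \sum_d (m a b d + m a' b d))).
  rewrite mulr_suml; apply: ler_sum => a _.
  rewrite mulr_suml; apply: ler_sum => a' _.
  rewrite mulr_suml; apply: ler_sum => b _.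
  case: (boolP [&& _, _, _ & _]) => [/and4P[/eqP ai /eqP a'i /eqP bj /negPf ne]|_]; last first.
    by rewrite mul0r; apply: sumr_ge0 => d _; rewrite addr_ge0.
  rewrite mul1r; apply: le_trans (rich (c a b)) _; apply: ler_sum => d _.
  rewrite -natrD ler_nat /mismatch ai a'i.
  have [xd|//] := eqVneq (c x d) (c a b); rewrite xd ne.
  by case: (i == c b d); rewrite ?andbF // addn1.
under eq_bigr => a _ do under eq_bigr => a' _ do
  (under eq_bigr => b _ do rewrite big_split /=; rewrite big_split /=).
under eq_bigr => a _ do rewrite big_split /= sumr_const_card.
rewrite big_split /= -mulr_sumr sumr_const_card -nV.
by apply: lerD; rewrite ler_pM2l.
Qed.

(* The average pair of N_i x N_j shares its colour with almost all others. *)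
Lemma majority_color (R : realFieldType) (V : finType) (s : nat)
    (c : V -> V -> 'I_s) (x : V) (i j : 'I_s) (n rho beta tau : R) :
  n = #|V|%:R -> 0 < n -> 0 < rho -> (forall a b, c a b = c b a) ->
  (forall k, rho * n <= \sum_u (c x u == k)%:R) ->
  \sum_a \sum_b \sum_d (mismatch c x a b d)%:R <= beta * n ^+ 3 ->
  4 * beta / rho ^+ 3 < tau ->
  exists k, \sum_a \sum_b [&& c x a == i, c x b == j & c a b != k]%:R <= tau * n ^+ 2.
Proof.
move=> nV n0 rho0 cC rich bad tau_gt.
pose B k : R := \sum_a \sum_b [&& c x a == i, c x b == j & c a b != k]%:R.
have [/existsP[k Bk]|] := boolP [exists k, B k <= tau * n ^+ 2]; first by exists k.
rewrite negb_exists => /forallP none; exfalso.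
have tau0 : 0 <= tau.
  apply: le_trans (ltW tau_gt).
  have : 0 <= beta * n ^+ 3 by apply: le_trans bad; do 3!apply: sumr_ge0 => ? _.
  by rewrite pmulr_lge0 ?exprn_gt0 // => b0;
    apply: divr_ge0; rewrite ?mulr_ge0 ?exprn_ge0 ?(ltW rho0).
(* If every colour fails, then so does the colour of each pair a'b' in N_i x N_j, and there are at
   least (rho n)^2 such pairs. *)
have lower : rho ^+ 2 * tau * n ^+ 4 <=
    \sum_a' \sum_b' (c x a' == i)%:R * ((c x b' == j)%:R * B (c a' b')).
  apply: (@le_trans _ _ ((\sum_a' (c x a' == i)%:R) *
            ((\sum_b' (c x b' == j)%:R) * (tau * n ^+ 2)))).
    rewrite (_ : _ * n ^+ 4 = (rho * n) * ((rho * n) * (tau * n ^+ 2))); last by ring.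
    have rn : 0 <= rho * n by rewrite ltW ?mulr_gt0.
    have tn : 0 <= tau * n ^+ 2 by rewrite mulr_ge0 ?sqr_ge0.
    by apply: ler_pM => //; [rewrite mulr_ge0 | rewrite ler_wpM2r].
  rewrite mulr_suml; apply: ler_sum => a' _; rewrite mulr_suml mulr_sumr.
  apply: ler_sum => b' _; rewrite !ler_wpM2l //.
  by rewrite ltW // ltNge none.
(* Pass from ab to a'b' through a'b: a change of colour occurs at one of the two moves, each bounded
   by [color_change_bound] with one free vertex. The total 4 beta / rho n^4, divided by rho^2 n^4,
   is the threshold for [tau]. *)
have upper : \sum_a' \sum_b' (c x a' == i)%:R * ((c x b' == j)%:R * B (c a' b'))
    <= n * (2 * beta / rho * n ^+ 3) + n * (2 * beta / rho * n ^+ 3).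
  have chg := color_change_bound _ _ nV n0 rho0 rich bad.
  pose h i j a a' b : R :=
    [&& c x a == i, c x a' == i, c x b == j & c a b != c a' b]%:R.
  apply: (@le_trans _ _ (\sum_a' \sum_b' \sum_a \sum_b (h i j a a' b + h j i b b' a'))).
    apply: ler_sum => a' _; apply: ler_sum => b' _.
    rewrite mulr_sumr mulr_sumr; apply: ler_sum => a _.
    rewrite mulr_sumr mulr_sumr; apply: ler_sum => b _.
    rewrite /h -!natrM -natrD ler_nat (cC b) (cC b').
    case: (c x a' == i); case: (c x b' == j); rewrite //= ?mul0n //.
    case: (c x a == i); case: (c x b == j); rewrite //= !mul1n.
    by have [->|_] := eqVneq (c a b) (c a' b); case: eqVneq.
  under eq_bigr => a' _ do under eq_bigr => b' _ do
    (under eq_bigr => a _ do rewrite big_split /=; rewrite big_split /=).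
  under eq_bigr => a' _ do rewrite big_split /= sumr_const_card.
  rewrite big_split /= -mulr_sumr -nV; apply: lerD.
    by rewrite ler_pM2l // exchange_big; apply: chg.
  under eq_bigr => a' _ do under eq_bigr => b' _ do rewrite sumr_const_card.
  under eq_bigr => a' _ do rewrite -mulr_sumr.
  rewrite -mulr_sumr -nV ler_pM2l // exchange_big /=.
  under eq_bigr => b' _ do rewrite exchange_big /=.
  by rewrite exchange_big /=; apply: chg.
have := le_trans lower upper.
rewrite (_ : n * _ + n * _ = 4 * beta / rho ^+ 3 * (rho ^+ 2 * n ^+ 4)); last first.
  by field; rewrite lt0r_neq0.
rewrite (_ : rho ^+ 2 * tau * n ^+ 4 = tau * (rho ^+ 2 * n ^+ 4)); last by ring.
rewrite ler_pM2r ?mulr_gt0 ?exprn_gt0 //.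
by rewrite leNgt tau_gt.
Qed.

(** * The group law on colours *)

(** At least m^4 quadruples have the prescribed colours, more than there are bad ones. Each law of
    the operation on colours is read off one such good quadruple. *)
Lemma pick_colored (R : realFieldType) (V : finType) (s : nat)
    (col : V -> 'I_s) (F : V -> V -> V -> V -> bool) (i1 i2 i3 i4 : 'I_s) (m : R) :
  0 <= m -> (forall k, m <= \sum_u (col u == k)%:R) ->
  \sum_a \sum_b \sum_d \sum_e (F a b d e)%:R < m ^+ 4 ->
  exists a b d e, [/\ col a = i1, col b = i2, col d = i3, col e = i4 & ~~ F a b d e].
Proof.
move=> m0 rich few.
have [/existsP[a /existsP[b /existsP[d /existsP[e /and5P[/eqP h1 /eqP h2 /eqP h3 /eqP h4 h]]]]]|] :=
  boolP [exists a, exists b, exists d, exists e,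
    [&& col a == i1, col b == i2, col d == i3, col e == i4 & ~~ F a b d e]].
  by exists a, b, d, e.
rewrite negb_exists => /forallP none; exfalso; move: few; apply/negP; rewrite -leNgt.
apply: (@le_trans _ _ ((\sum_a (col a == i1)%:R) * ((\sum_b (col b == i2)%:R) *
   ((\sum_d (col d == i3)%:R) * (\sum_e (col e == i4)%:R))))).
  by rewrite !exprS expr0 mulr1 !ler_pM ?mulr_ge0.
rewrite mulr_suml; apply: ler_sum => a _; rewrite mulr_suml mulr_sumr.
apply: ler_sum => b _; rewrite mulr_suml !mulr_sumr.
apply: ler_sum => d _; rewrite !mulr_sumr.
apply: ler_sum => e _; rewrite -!natrM ler_nat.
have := none a; rewrite negb_exists => /forallP/(_ b).
rewrite negb_exists => /forallP/(_ d); rewrite negb_exists => /forallP/(_ e).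
by case: (col a == _); case: (col b == _); case: (col d == _); case: (col e == _);
  case: (F _ _ _ _).
Qed.

Lemma sum4_or (R : realFieldType) (V : finType) (F G : V -> V -> V -> V -> bool) (x y : R) :
  \sum_a \sum_b \sum_d \sum_e (F a b d e)%:R <= x ->
  \sum_a \sum_b \sum_d \sum_e (G a b d e)%:R <= y ->
  \sum_a \sum_b \sum_d \sum_e (F a b d e || G a b d e)%:R <= x + y.
Proof.
move=> Fx Gy; apply: le_trans (lerD Fx Gy).
rewrite -big_split; apply: ler_sum => a _; rewrite -big_split; apply: ler_sum => b _.
rewrite -big_split; apply: ler_sum => d _; rewrite -big_split; apply: ler_sum => e _.
by rewrite /= -natrD ler_nat; case: (F _ _ _ _) => //; case: (G _ _ _ _).
Qed.

(** These are the positions at which an exceptional pair occurs in the quadruples used for the group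
    laws. *)
Lemma sum4_dummies (R : realFieldType) (V : finType) (f : V -> V -> R) (n : R) :
  n = #|V|%:R ->
  let S := n ^+ 2 * \sum_a \sum_b f a b in
  [/\ \sum_a \sum_b \sum_(d : V) \sum_(e : V) f a b = S,
      \sum_a \sum_(b : V) \sum_d \sum_(e : V) f a d = S,
      \sum_(a : V) \sum_b \sum_(d : V) \sum_e f b e = S
    & \sum_(a : V) \sum_(b : V) \sum_d \sum_e f d e = S].
Proof.
move=> nV S; have E k : \sum_(x : V) k = n * k by rewrite sumr_const_card nV.
have S12 : \sum_a \sum_b \sum_(d : V) \sum_(e : V) f a b = S.
  rewrite /S expr2 -mulrA mulr_sumr mulr_sumr; apply: eq_bigr => a _.
  by rewrite !mulr_sumr; apply: eq_bigr => b _; rewrite !E.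
split=> //.
- by rewrite -S12; apply: eq_bigr => a _; rewrite exchange_big.
- rewrite E; under eq_bigr => b _ do rewrite E.
  by rewrite -mulr_sumr mulrA -expr2.
by rewrite !E mulrA -expr2.
Qed.

Lemma color_count_power_of_two (R : realFieldType) (V : finType) (s : nat)
    (c : V -> V -> 'I_s) (n delta : R) :
  n = #|V|%:R -> 0 < n -> (0 < s)%N -> (forall a b, c a b = c b a) ->
  0 < delta -> delta * (10 ^+ 6 * s%:R ^+ 7) <= 1 ->
  \sum_a \sum_b \sum_d \sum_e (c a b == c d e)%:R <= n ^+ 4 / s%:R + delta * n ^+ 4 ->
  \sum_a \sum_b \sum_d \sum_e (mismatch c a b d e)%:R <= delta * n ^+ 4 ->
  exists p, s = (2 ^ p)%N.
Proof.
move=> nV n0 s_gt0 cC delta0 dle cQ bad.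
have s0 : 0 < s%:R :> R by rewrite ltr0n.
have s1 : 1 <= s%:R :> R by rewrite ler1n.
pose y : R := s%:R^-1.
have y0 : 0 < y by rewrite invr_gt0.
have y1 : y <= 1 by rewrite invf_le1.
have dy : delta <= y ^+ 7 / 10 ^+ 6.
  rewrite (_ : y ^+ 7 / 10 ^+ 6 = 1 / (10 ^+ 6 * s%:R ^+ 7)).
    by rewrite ler_pdivlMr ?mulr_gt0 ?exprn_gt0.
  by rewrite /y; field; rewrite lt0r_neq0.
have y74 : y ^+ 7 <= y ^+ 4.
  by rewrite (exprD y 4 3) ler_piMr ?exprn_ge0 ?exprn_ile1 ?(ltW y0).
have y4 : 0 < y ^+ 4 by rewrite exprn_gt0.
have d16 : delta <= 1 / (16 * s%:R ^+ 4).
  rewrite (_ : 1 / _ = y ^+ 4 / 16); last by rewrite /y; field; rewrite lt0r_neq0.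
  by move: (y ^+ 7) (y ^+ 4) dy y74 y4 => u v; lra.
have [x rich badx] := rich_vertex nV n0 s_gt0 delta0 d16 cQ bad.
pose rho : R := y / 4.
have rho0 : 0 < rho by rewrite divr_gt0.
have {}rich k : rho * n <= \sum_u (c x u == k)%:R.
  by rewrite (_ : rho * n = n / (4 * s%:R)) // /rho /y; field; rewrite lt0r_neq0.
(* The factor 10 exceeds the 4 * 2 required by [majority_color] with beta = 2 delta. Exceptional
   sets of density about delta / rho^3 must stay below rho^4, where rho = 1 / (4 s); hence the power
   s^7. *)
pose tau : R := 10 * delta / rho ^+ 3.
have budget : tau + tau + tau + tau + 2 * delta < rho ^+ 4.
  have tle : tau <= 640 / 10 ^+ 6 * y ^+ 4.
    rewrite ler_pdivrMr ?exprn_gt0 //.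
    rewrite (_ : _ * rho ^+ 3 = 10 * (y ^+ 7 / 10 ^+ 6)); last by rewrite /rho; field.
    by rewrite ler_pM2l.
  rewrite (_ : rho ^+ 4 = y ^+ 4 / 256); last by rewrite /rho; field.
  by move: (y ^+ 7) (y ^+ 4) tau dy y74 y4 tle => u v w; lra.
have tau_gt : 4 * (2 * delta) / rho ^+ 3 < tau.
  by rewrite ltr_pM2r ?invr_gt0 ?exprn_gt0 //; lra.
have tau0 : 0 < tau.
  by apply: divr_gt0; [apply: mulr_gt0 | apply: exprn_gt0].
clearbody tau.
have maj i j := majority_color i j nV n0 rho0 cC rich badx tau_gt.
(* This is the i + j of the overview: a colour that almost all pairs of N_i x N_j take. The
   exceptions are marked by [t]. *)
pose op i j := xchoose (maj i j).
pose t i j a b := [&& c x a == i, c x b == j & c a b != op i j].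
have tE i j a b : c x a = i -> c x b = j -> ~~ t i j a b -> c a b = op i j.
  by move=> ai bj; rewrite /t ai bj !eqxx /= negbK => /eqP.
have tle i j : n ^+ 2 * (\sum_a \sum_b (t i j a b)%:R) <= tau * n ^+ 4.
  rewrite (_ : tau * n ^+ 4 = n ^+ 2 * (tau * n ^+ 2)); last by ring.
  by rewrite ler_pM2l ?exprn_gt0 //; apply: (xchooseP (maj i j)).
have t21 i j : \sum_a \sum_b \sum_(d : V) \sum_(e : V) (t i j b a)%:R <= tau * n ^+ 4.
  have [-> _ _ _] := sum4_dummies (fun a b => (t i j b a)%:R) nV.
  by rewrite exchange_big; apply: tle.
have badx4 : \sum_b \sum_a \sum_d \sum_(e : V) (mismatch c x a b d)%:R
    <= 2 * delta * n ^+ 4.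
  rewrite exchange_big /=.
  have -> : \sum_a \sum_b \sum_d \sum_(e : V) (mismatch c x a b d)%:R
     = n * \sum_a \sum_b \sum_d (mismatch c x a b d)%:R :> R.
    rewrite mulr_sumr; apply: eq_bigr => a _; rewrite mulr_sumr; apply: eq_bigr => b _.
    by rewrite mulr_sumr; apply: eq_bigr => d _; rewrite sumr_const_card nV.
  by rewrite (_ : _ * n ^+ 4 = n * (2 * delta * n ^+ 3)) ?ler_pM2l //; ring.
have small u : u <= tau + tau + tau + tau + 2 * delta -> u * n ^+ 4 < (rho * n) ^+ 4.
  by move=> ule; rewrite exprMn ltr_pM2r ?exprn_gt0 // (le_lt_trans ule).
have pick := pick_colored _ _ _ _ (ltW (mulr_gt0 rho0 n0)) rich.
have opC : commutative op.
  move=> i j.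
  have [|a [b [_ [_ [ai bj _ _]]]]] := pick (fun a b _ _ => t i j a b || t j i b a) i j i i.
    apply: (@le_lt_trans _ _ (tau * n ^+ 4 + tau * n ^+ 4)).
      apply: sum4_or => //; have [-> _ _ _] := sum4_dummies (fun a b => (t i j a b)%:R) nV.
      exact: tle.
    by rewrite -mulrDl; apply: small; lra.
  by rewrite negb_or => /andP[/(tE _ _ _ _ ai bj) <- /(tE _ _ _ _ bj ai) <-].
have opK' i j : op j (op i j) = i.
  (* Take a, b, d in N_i, N_j, N_(i+j). Then xd and ab both have colour i + j, so the matching xa,
     bd is monochromatic too: i = j + (i + j). *)
  have [|b [a [d [_ [bj ai dk _]]]]] := pick (fun b a d _ => t i j a b || t j (op i j) b d
      || mismatch c x a b d) j i (op i j) i.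
    apply: (@le_lt_trans _ _ (tau * n ^+ 4 + tau * n ^+ 4 + 2 * delta * n ^+ 4)).
      apply: sum4_or => //; apply: sum4_or => //.
      have [_ -> _ _] := sum4_dummies (fun b d => (t j (op i j) b d)%:R) nV.
      exact: tle.
    by rewrite -!mulrDl; apply: small; lra.
  rewrite !negb_or => /andP[/andP[/(tE _ _ _ _ ai bj) abE /(tE _ _ _ _ bj dk) <-]].
  rewrite /mismatch negbK => /andP[_].
  by rewrite dk abE eqxx eqb_id ai => /eqP.
have opK i j : op i (op i j) = j by rewrite (opC i j) opK'.
have opA : associative op.
  move=> i j k; set l := op i j; set m := op j k.
  (* Take v, a, d, w in N_l, N_i, N_k, N_m. Then va has colour (i + j) + i = j and dw has colour k +
     (j + k) = j, so vd and aw agree: (i + j) + k = i + (j + k). *)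
  have [|v [a [d [w [vl ai dk wm]]]]] := pick (fun v a d w => t l i v a || t k m d w
      || t l k v d || t i m a w || mismatch c v a d w) l i k m.
    apply: (@le_lt_trans _ _ (tau * n ^+ 4 + tau * n ^+ 4 + tau * n ^+ 4 + tau * n ^+ 4
                              + delta * n ^+ 4)).
      apply: sum4_or => //; apply: sum4_or; last first.
        by have [_ _ -> _] := sum4_dummies (fun a b => (t i m a b)%:R) nV; apply: tle.
      apply: sum4_or; last first.
        by have [_ -> _ _] := sum4_dummies (fun a b => (t l k a b)%:R) nV; apply: tle.
      apply: sum4_or.
        by have [-> _ _ _] := sum4_dummies (fun a b => (t l i a b)%:R) nV; apply: tle.
      by have [_ _ _ ->] := sum4_dummies (fun a b => (t k m a b)%:R) nV; apply: tle.
    by rewrite -!mulrDl; apply: small; lra.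
  rewrite !negb_or => /andP[/andP[/andP[/andP[/(tE _ _ _ _ vl ai) va /(tE _ _ _ _ dk wm) dw]
    /(tE _ _ _ _ vl dk) vd] /(tE _ _ _ _ ai wm) aw]].
  rewrite /mismatch negbK => /andP[+ _]; rewrite va dw vd aw.
  have -> : op l i = j by rewrite opC opK.
  by rewrite opK' eqxx => /eqP/esym/eqP.
have [|p] := card_boolean_group _ opA opC opK; rewrite card_ord //.
by move=> ->; exists p.
Qed.

(** * Stability in terms of densities *)

(** Let E, I, Q count adjacent, adjacent monochromatic and monochromatic pairs. The colouring gives
    E + I + Q <= N^2 and convexity gives Q >= N^2 / s, so density forces I <= eps N^2. The pairs at
    odds with the complete multipartite graph number N^2 + 2 I - E - Q. *)
Lemma turan_stability (R : realFieldType) (P : finType) (G : rel P) (s : nat) (N eps : R) :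
  N = #|P|%:R -> (0 < s)%N -> symmetric G ->
  (forall t : seq P, pairwise G t -> (size t <= s)%N) ->
  (1 - 1 / s%:R - eps) * N ^+ 2 <= \sum_x \sum_y (G x y)%:R ->
  exists col : P -> 'I_s,
    [/\ forall x y, G x =1 G y -> col x = col y,
        \sum_x \sum_y (col x == col y)%:R <= N ^+ 2 / s%:R + eps * N ^+ 2
      & \sum_x \sum_y (G x y == (col x == col y))%:R <= 3 * eps * N ^+ 2].
Proof.
move=> NP s_gt0 symG cliques dense.
have [|col0 [lt_col colG]] := @clique_free_coloring_in P G s [set: P] symG.
  by move=> t _; apply: cliques.
rewrite cardsT => sum_le.
pose col x := Ordinal (lt_col x (in_setT x)).
have s0 : 0 < s%:R :> R by rewrite ltr0n.
pose E : R := \sum_x \sum_y (G x y)%:R.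
pose I : R := \sum_x \sum_y (G x y && (col x == col y))%:R.
pose Q : R := \sum_x \sum_y (col x == col y)%:R.
have allT : (fun x => x \in [set: P]) =1 xpredT by move=> x; rewrite in_setT.
have EIQ : E + I + Q <= N ^+ 2.
  rewrite NP -natrX; move: sum_le; rewrite -(ler_nat R); apply: le_trans.
  rewrite natr_sum (eq_bigl _ _ allT) -!big_split; apply: ler_sum => x _ /=.
  rewrite natr_sum (eq_bigl _ _ allT) -!big_split; apply: ler_sum => y _ /=.
  by rewrite -!natrD ler_nat.
have Qge : N ^+ 2 / s%:R <= Q.
  have NE : N = \sum_(x : P) 1 by rewrite sumr_const_card mulr1.
  have := fiber_variance col (Ordinal s_gt0) NE; apply: le_trans.
  by rewrite lerDr sqr_ge0.
have I0 : 0 <= I by do 2!apply: sumr_ge0 => ? _.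
have disE : \sum_x \sum_y (G x y == (col x == col y))%:R + E + Q = N ^+ 2 + 2 * I.
  have -> : N ^+ 2 = \sum_(x : P) \sum_(y : P) 1.
    by rewrite !sumr_const_card mulr1 -NP -expr2.
  rewrite mulr_sumr -!big_split; apply: eq_bigr => x _ /=.
  rewrite mulr_sumr -!big_split; apply: eq_bigr => y _ /=.
  by case: (G x y); case: (col x == col y) => /=; ring.
have {}dense : N ^+ 2 - N ^+ 2 / s%:R - eps * N ^+ 2 <= E.
  by apply: le_trans dense; rewrite !mulrBl !mul1r [_^-1 * _]mulrC.
exists col; split; first by move=> x y /colG xy; apply: val_inj.
  by rewrite -/Q; move: EIQ dense I0; move: (N ^+ 2 / _) (eps * _) => u v; lra.
rewrite -mulrA; move: EIQ dense I0 Qge disE.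
by move: (N ^+ 2 / _) (eps * _) (\sum_x _) => u v w; lra.
Qed.

(** * From the hypergraph to the graph on pairs *)

(** The points are all ordered pairs, so that sums range freely over V^4. For 4-uniform H, adjacency
    forces four distinct vertices, and degenerate pairs (a, a) are isolated. *)
Definition quad_rel (V : finType) (H : {set {set V}}) : rel (V * V) :=
  fun x y => [set x.1; x.2; y.1; y.2] \in H.

Lemma quad_relC (V : finType) (H : {set {set V}}) : symmetric (quad_rel H).
Proof.
move=> x y; rewrite /quad_rel; congr (_ \in H); apply/setP=> z; rewrite !inE.
by do 4!case: (z == _).
Qed.

Lemma quad_rel_uniq (n : nat) (H : {set {set 'I_n}}) (x y : 'I_n * 'I_n) :
  uniform4 H -> quad_rel H x y -> uniq [:: x.1; x.2; y.1; y.2].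
Proof.
move=> /forall_inP H4 /H4 /eqP xy4; apply/card_uniqP; rewrite -[RHS]xy4.
by apply: eq_card => z; rewrite !inE !orbA.
Qed.

(** Adjacent points are disjoint pairs of vertices, so r points of a clique serve as the sets
    P_i. *)
Lemma quad_rel_clique (r n : nat) (H : {set {set 'I_n}}) (t : seq ('I_n * 'I_n)) :
  (1 < r)%N -> uniform4 H -> pairwise (quad_rel H) t -> (r <= size t)%N ->
  contains_Cr r H.
Proof.
move=> r1 H4; case: t => [|p0 t']; first by rewrite leqn0 => _ /eqP r0; rewrite r0 in r1.
set t := p0 :: t' => ct rt.
pose p (i : 'I_r) := nth p0 t i.
have adj i j : i != j -> quad_rel H (p i) (p j).
  have size_t (k : 'I_r) : (k < size t)%N := leq_trans (ltn_ord k) rt.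
  rewrite neq_ltn => /orP[ij|ji].
    by apply: (pairwiseP p0 ct); rewrite ?inE.
  by rewrite quad_relC; apply: (pairwiseP p0 ct); rewrite ?inE.
have adj_uniq i j : i != j -> uniq [:: (p i).1; (p i).2; (p j).1; (p j).2].
  by move=> /adj; apply: quad_rel_uniq.
exists (fun x => if x.2 == ord0 then (p x.1).1 else (p x.1).2); split.
  move=> [i b] [j b'] /=.
  have [<-|ij] := eqVneq i j; last first.
    have := adj_uniq i j ij; rewrite /= !inE !negb_or.
    move=> /and4P[/and3P[_ /eqP ac /eqP ad] /andP[/eqP bc /eqP bd] _ _].
    by case: (b == _); case: (b' == _) => E;
      [case: (ac E) | case: (ad E) | case: (bc E) | case: (bd E)].
  have [j' ij'] : exists j' : 'I_r, i != j'.
    case: (eqVneq i (Ordinal r1)) => [->|]; last by exists (Ordinal r1).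
    by exists (Ordinal (ltnW r1)).
  have := adj_uniq i j' ij'; rewrite /= !inE !negb_or.
  move=> /and4P[/and3P[/eqP ab _ _] _ _ _].
  by case: b b' => [[|[|//]] ?] [[|[|//]] ?] //= E; first [case: (ab E) | case: (ab (esym E)) |
     congr (_, _); apply: val_inj].
move=> i j /adj; rewrite /quad_rel; congr (_ \in H).
apply/setP=> z; apply/idP/imsetP; last first.
  by case=> [[k b]]; rewrite !inE /= => /orP[] /eqP -> ->; case: ifP; rewrite eqxx ?orbT.
rewrite !inE -!orbA => /or4P[] /eqP ->.
- by exists (i, ord0); rewrite ?inE ?eqxx.
- by exists (i, ord_max); rewrite ?inE ?eqxx.
- by exists (j, ord0); rewrite ?inE ?eqxx ?orbT.
by exists (j, ord_max); rewrite ?inE ?eqxx ?orbT.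
Qed.

(** Every edge comes from its 24 orderings, each read as two ordered pairs. *)
Lemma quad_rel_count (n : nat) (H : {set {set 'I_n}}) :
  uniform4 H -> (24 * #|H| <= \sum_x \sum_y quad_rel H x y)%N.
Proof.
move=> /forall_inP H4.
have -> : (\sum_x \sum_y quad_rel H x y =
    \sum_(h in H) \sum_x \sum_y ([set x.1; x.2; y.1; y.2] == h))%N.
  rewrite [RHS]exchange_big /=; apply: eq_bigr => x _.
  rewrite [RHS]exchange_big /=; apply: eq_bigr => y _.
  rewrite -[RHS]big_mkcondr /= sum1_card /quad_rel; set A := [set _; _; _; _].
  have [AH|AH] := boolP (A \in H).
    rewrite (@eq_card1 _ A) // => h; rewrite unfold_in /= !inE [A == h]eq_sym andbC.
    by case: eqVneq => // ->.
  rewrite eq_card0 // => h; rewrite unfold_in /= !inE; apply/negP => /andP[hH /eqP Ah].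
  by rewrite Ah hH in AH.
rewrite mulnC -sum_nat_const; apply: leq_sum => h hH.
have -> : (24 = #|[set t : 4.-tuple 'I_n | all (mem h) t & uniq t]|)%N.
  by rewrite card_uniq_tuples (eqP (H4 h hH)).
pose g (t : 4.-tuple 'I_n) := ((tnth t 0, tnth t 1), (tnth t 2, tnth t 3)).
have g_inj : injective g.
  move=> t u [t0 t1 t2 t3]; apply: eq_from_tnth => k.
  have tu (i : 'I_4) : tnth t i = tnth u i -> val i = val k -> tnth t k = tnth u k.
    by move=> + /val_inj <-.
  by case: k tu => [[|[|[|[|//]]]] lt_k] tu;
    [apply: (tu _ t0) | apply: (tu _ t1) | apply: (tu _ t2) | apply: (tu _ t3)].
rewrite -(card_imset _ g_inj) pair_bigA /=.
rewrite -sum1_card big_mkcond /=; apply: leq_sum => q _.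
case: ifP => // /imsetP[t]; rewrite inE => /andP[/allP th ut] -> /=.
rewrite lt0b; set A := [set _; _; _; _].
have At : A =i t.
  move=> z; rewrite {}/A !inE !(tnth_nth z).
  by case: (t) => [[|a [|b [|d [|e [|f l]]]]] // sz]; rewrite [RHS]inE !inE !orbA.
rewrite eqEcard (eqP (H4 h hH)) (eq_card At) (card_uniqP ut) size_tuple andbT.
by apply/subsetP=> z; rewrite At => /th.
Qed.

Lemma bin4_lower_bound (R : realFieldType) (n : nat) :
  (3 <= n)%N -> n%:R ^+ 4 - 6 * n%:R ^+ 3 <= 24 * 'C(n, 4)%:R :> R.
Proof.
move=> n3.
have -> : 24 * 'C(n, 4)%:R = n%:R * (n%:R - 1) * (n%:R - 2) * (n%:R - 3) :> R.
  rewrite -natrM mulnC -[24%N]/(4`!) bin_ffact !ffactnS ffactn0 muln1 -!subn1 -!subnDA.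
  by rewrite !natrM !natrB ?(leq_trans _ n3) // !mulrA.
have : 3 <= n%:R :> R by rewrite ler_nat.
by move: (n%:R) => x; nra.
Qed.

(** One 1 / K is the gap in the hypothesis. The other pays for replacing 24 binom(n, 4) by n^4,
    since 6 n^3 <= n^4 / K when n >= 6 K. *)
Lemma dense_quad_rel (R : realFieldType) (n s K : nat) (H : {set {set 'I_n}}) :
  uniform4 H -> (1 < s)%N -> (1 < K)%N -> (6 * K <= n)%N ->
  ((s - 1)%:R / s%:R - 1 / K%:R) * 'C(n, 4)%:R <= (#|H|%:R : R) ->
  (1 - 1 / s%:R - 2 / K%:R) * n%:R ^+ 4 <=
    \sum_x \sum_y (quad_rel H x y)%:R :> R.
Proof.
move=> H4 s1 K1 nK; have s0 : 0 < s%:R :> R by rewrite ltr0n ltnW.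
have K0 : 0 < K%:R :> R by rewrite ltr0n ltnW.
have -> : (s - 1)%:R / s%:R = 1 - 1 / s%:R :> R.
  by rewrite natrB 1?ltnW //; field; rewrite lt0r_neq0.
move=> Hge.
have count : 24 * #|H|%:R <= \sum_x \sum_y (quad_rel H x y)%:R :> R.
  have := quad_rel_count H4; rewrite -(ler_nat R) natrM natr_sum.
  by under eq_bigr => x _ do rewrite natr_sum.
apply: le_trans count.
have n3 : (3 <= n)%N by apply: leq_trans nK; rewrite (leq_trans _ (leq_pmulr _ (ltnW K1))).
have binge := bin4_lower_bound R n3.
have s_half : 1 / s%:R <= 1 / 2 :> R by rewrite !mul1r lef_pV2 ?posrE // ler_nat.
have K_half : 1 / K%:R <= 1 / 2 :> R by rewrite !mul1r lef_pV2 ?posrE // ler_nat.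
have sV0 : 0 < 1 / s%:R :> R by rewrite divr_gt0.
have KV0 : 0 < 1 / K%:R :> R by rewrite divr_gt0.
have n3_0 : 0 <= n%:R ^+ 3 :> R by rewrite exprn_ge0.
have nK4 : 6 * n%:R ^+ 3 <= 1 / K%:R * n%:R ^+ 4 :> R.
  rewrite mulrAC mul1r ler_pdivlMr // exprS mulrAC ler_wpM2r //.
  by rewrite -natrM ler_nat.
rewrite (_ : 2 / K%:R = 2 * (1 / K%:R)); last by rewrite mul1r.
move: Hge binge nK4 s_half K_half sV0 KV0 n3_0.
move: (1 / s%:R) (1 / K%:R) (n%:R ^+ 4) (n%:R ^+ 3) ('C(n, 4)%:R) (#|H|%:R).
by move=> u v p q b h; nra.
Qed.

Lemma power_of_two_from_density (R : realFieldType) (n s K : nat) (H : {set {set 'I_n}}) :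
  10 ^+ 8 * s%:R ^+ 7 <= K%:R :> R -> (1 < s)%N -> (6 * K <= n)%N -> uniform4 H ->
  ((s - 1)%:R / s%:R - 1 / K%:R) * 'C(n, 4)%:R <= (#|H|%:R : R) ->
  ~ contains_Cr s.+1 H -> exists p, s = (2 ^ p)%N.
Proof.
move=> Kge s1 nK H4 Hge noC.
have s0 : 1 <= s%:R :> R by rewrite ler1n ltnW.
have s7 : 1 <= s%:R ^+ 7 :> R by rewrite exprn_ege1.
have K2 : 2 <= K%:R :> R by lra.
have K1 : (1 < K)%N by rewrite ler_nat in K2.
have K0 : 0 < K%:R :> R by lra.
have n_gt0 : (0 < n)%N by apply: leq_trans nK; rewrite muln_gt0 /= ltnW.
have nV : n%:R = #|'I_n|%:R :> R by rewrite card_ord.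
have n0 : 0 < n%:R :> R by rewrite ltr0n.
have N2 : n%:R ^+ 2 = #|{: 'I_n * 'I_n}|%:R :> R by rewrite card_prod card_ord natrM.
have dense := dense_quad_rel H4 s1 K1 nK Hge.
have [||col [colG colQ colD]] :=
  @turan_stability R _ (quad_rel H) s _ (2 / K%:R) N2 (ltnW s1) (@quad_relC _ H).
- move=> t ct; rewrite leqNgt; apply/negP => st; apply: noC.
  exact: (quad_rel_clique (leqW s1) H4 ct st).
- by rewrite -exprM.
pose c a b := col (a, b).
have cC a b : c a b = c b a.
  by apply: colG => x; rewrite /quad_rel (setUC [set a]).
have D1 : \sum_a \sum_b \sum_d \sum_e
    (([set a; b; d; e] \in H) == (c a b == c d e))%:R <= 6 / K%:R * n%:R ^+ 4 :> R.
  rewrite sum_pairs; apply: le_trans (_ : _ <= 3 * (2 / K%:R) * n%:R ^+ 2 ^+ 2) _.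
    apply: le_trans colD; rewrite le_eqVlt; apply/orP; left; apply/eqP.
    by apply: eq_bigr => -[a b] _; apply: eq_bigr => -[d e] _.
  by rewrite -exprM mulrA -natrM.
(* The gap 2 / K becomes 6 / K in [turan_stability], once for each of the three matchings. *)
have delta0 : 0 < 18 / K%:R :> R by rewrite divr_gt0.
apply: (@color_count_power_of_two R 'I_n s c n%:R (18 / K%:R)) => //.
- exact: ltnW.
- by rewrite mulrAC ler_pdivrMr // mul1r; apply: le_trans Kge; lra.
- rewrite sum_pairs; apply: le_trans (_ : _ <= n%:R ^+ 2 ^+ 2 / s%:R + 2 / K%:R * n%:R ^+ 2 ^+ 2) _.
    apply: le_trans colQ; rewrite le_eqVlt; apply/orP; left; apply/eqP.
    by apply: eq_bigr => -[a b] _; apply: eq_bigr => -[d e] _.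
  rewrite -exprM lerD2l ler_pM2r ?exprn_gt0 // ler_pM2r ?invr_gt0 //; lra.
(* In a mismatch some matching is wrong about membership in H, for all three matchings have the same
   union. *)
pose dis a b d e := ([set a; b; d; e] \in H) == (c a b == c d e).
apply: le_trans (_ : _ <= 6 / K%:R * n%:R ^+ 4 + 6 / K%:R * n%:R ^+ 4 + 6 / K%:R * n%:R ^+ 4) _.
  apply: (@le_trans _ _ (\sum_a \sum_b \sum_d \sum_e
    (dis a b d e || dis a d b e || dis a e b d)%:R)).
    apply: ler_sum => a _; apply: ler_sum => b _; apply: ler_sum => d _.
    apply: ler_sum => e _; rewrite ler_nat /mismatch /dis.
    have -> : [set a; d; b; e] = [set a; b; d; e].
      by apply/setP=> z; rewrite !inE; do 4!case: (z == _).
    have -> : [set a; e; b; d] = [set a; b; d; e].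
      by apply/setP=> z; rewrite !inE; do 4!case: (z == _).
    case: (_ \in H); case: (c a b == _); case: (c a d == _); by case: (c a e == _).
  apply: sum4_or; first apply: sum4_or => //.
    apply: le_trans D1; rewrite le_eqVlt; apply/orP; left; apply/eqP.
    by apply: eq_bigr => a _; rewrite exchange_big.
  apply: le_trans D1; rewrite le_eqVlt; apply/orP; left; apply/eqP.
  apply: eq_bigr => a _; under eq_bigr => b _ do rewrite exchange_big /=.
  by rewrite exchange_big.
by rewrite -!mulrDl le_eqVlt; apply/orP; left; apply/eqP; field; rewrite lt0r_neq0.
Qed.

(** * Conclusion *)

Lemma density_gap_bound (R : realFieldType) (r : nat) :
  (0 < r)%N -> 10 ^+ 8 * (r - 1)%:R ^+ 7 <= (10 ^ 33 * r ^ 70)%:R :> R.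
Proof.
move=> r0; rewrite natrM !natrX; apply: ler_pM; rewrite ?exprn_ge0 //.
  by apply: ler_weXn2l => //; rewrite ler1n.
apply: (@le_trans _ _ (r%:R ^+ 7)).
  by apply: lerXn2r; rewrite ?nnegrE // ler_nat leq_subr.
by apply: ler_weXn2l => //; rewrite ler1n.
Qed.

Local Close Scope ring_scope.

Theorem theorem2 :
  forall r : nat, (3 <= r)%N ->
  exists N : nat, forall n : nat, (N <= n)%N ->
  forall H : {set {set 'I_n}},
    uniform4 H ->
    ((((r - 2)%:R / (r - 1)%:R - 1 / (10 ^ 33 * r ^ 70)%:R) * 'C(n, 4)%:R
        <= (#|H|%:R : rat))%R) ->
    ~ contains_Cr r H ->
    exists p : nat, (1 <= p)%N /\ r = (2 ^ p).+1.
Proof.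
move=> r r3; have r0 : (0 < r)%N := ltn_trans (isT : (0 < 2)%N) r3.
(* The number of colours is s = r - 1, and of K only 10^8 s^7 <= K is kept. *)
move: (10 ^ 33 * r ^ 70)%N (density_gap_bound rat r0) => K /power_of_two_from_density key.
exists (6 * K)%N => n nK H H4; rewrite (_ : (r - 2 = r - 1 - 1)%N); last by rewrite -subnDA.
move=> Hge noC.
have r1 : (r - 1).+1 = r by rewrite subn1 prednK.
have s1 : (1 < r - 1)%N by rewrite ltn_subRL.
have [|p sE] := key n H s1 nK H4 Hge; first by rewrite r1.
(* The case p = 0 would give r - 1 = 1, against r >= 3. *)
by exists p; rewrite -sE r1; split=> //; case: p sE s1 => // ->.
Qed.
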